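(* (Pythagorean Theorem) Let $n$ be an integer with $n\neq0,-1$, let $0<\alpha<\alpha_0$, and let $T_{2n}(\alpha)$ be the hyperbolic twist knot cone-manifold with cone-angle $\alpha$. Let $\rho$ be the complex distance between the oriented axes of $S$ and $T$, the holonomy images of the meridian generators $s$ and $t$, and let $\gamma_\alpha$ be the complex length of the longitude. Then $$i\cosh\rho=\cot\frac{\alpha}{2}\,\tanh\left(\frac{\gamma_\alpha}{4}+\frac{i\alpha}{2}\right).$$
   Context: $T_m\subset S^3$ is the twist knot with $2$ right-handed horizontal crossings (a clasp) and $m$ right-handed vertical crossings (half-twists; negative $m$ means left-handed), considered up to mirror image; e.g. $T_2=4_1$, $T_{-4}=5_2$, $T_4=6_1$, while $T_0$ is the unknot and $T_{-2}$ the trefoil. With $X_{2n}$ the exterior of $T_{2n}$, $$\pi_1(X_{2n})=\langle s,t\mid swt^{-1}w^{-1}=1\rangle,\qquad w=(ts^{-1}t^{-1}s)^n,$$ with $s,t$ meridians. Let $w^*$ be the word $w$ read backwards, i.e. $w^*=(st^{-1}s^{-1}t)^n$, and put $l=w^*w$, $l_*=ww^*$. These are null-homologous longitudes; $l$ commutes with $t$, $l_*$ commutes with $s$, and $w^{-1}sw=t$, $w^{-1}l_*w=l$. $T_{2n}(\alpha)$ is the cone-manifold with underlying space $S^3$, singular set $T_{2n}$ and cone-angle $\alpha$; $\alpha_0\in[\frac{2\pi}{3},\pi)$ is the angle such that $T_{2n}(\alpha)$ is hyperbolic for $\alpha\in(0,\alpha_0)$, Euclidean for $\alpha=\alpha_0$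 and spherical for $\alpha\in(\alpha_0,\pi]$. For $0<\alpha<\alpha_0$ let $\eta:\pi_1(X_{2n})\to\mathrm{SL}(2,\mathbb{C})$ be the lift of the holonomy of $T_{2n}(\alpha)$ such that $S=\eta(s)$, $T=\eta(t)$ have trace $2\cos\frac{\alpha}{2}$. Up to conjugation, $$S=\begin{pmatrix}\cos\frac{\alpha}{2}& ie^{\rho/2}\sin\frac{\alpha}{2}\\ ie^{-\rho/2}\sin\frac{\alpha}{2}&\cos\frac{\alpha}{2}\end{pmatrix},\qquad T=\begin{pmatrix}\cos\frac{\alpha}{2}& ie^{-\rho/2}\sin\frac{\alpha}{2}\\ ie^{\rho/2}\sin\frac{\alpha}{2}&\cos\frac{\alpha}{2}\end{pmatrix},$$ and $\rho$ is the complex distance between the oriented axes of $S$ and $T$ in $\mathbb{H}^3$. The complex length $\gamma_\alpha$ of the longitude satisfies $\operatorname{tr}\eta(l)=\operatorname{tr}\eta(l_* )=2\cosh\frac{\gamma_\alpha}{2}$, with sign normalized as follows: after a conjugation taking $T$ to $\operatorname{diag}(e^{i\alpha/2},e^{-i\alpha/2})$, $\eta(l)=\operatorname{diag}(e^{\gamma_\alpha/2},e^{-\gamma_\alpha/2})$ (equivalently, the same with $S$ and $\eta(l_* )$ in place of $T$ and $\eta(l)$). Thus $\gamma_\alpha$ is determined modulo $4\pi i\mathbb{Z}$. *)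

(* Defs.v *)
From HB Require Import structures.
From mathcomp Require Import all_boot all_order all_algebra.
From mathcomp Require Import complex.
From mathcomp Require Import all_classical all_reals all_analysis.

Set Implicit Arguments.
Unset Strict Implicit.
Unset Printing Implicit Defensive.

Import Order.TTheory GRing.Theory Num.Theory.
Import numFieldNormedType.Exports.

Local Open Scope classical_set_scope.
Local Open Scope ring_scope.
Local Open Scope complex_scope.

Definition cosh {R : realType} (x : R) : R := (expR x + expR (- x)) / 2.
Definition sinh {R : realType} (x : R) : R := (expR x - expR (- x)) / 2.
Definition arcosh {R : realType} (x : R) : R := ln (x + Num.sqrt (x ^+ 2 - 1)).
Definition cot {R : realType} (x : R) : R := cos x / sin x.

Definition expC {R : realType} (z : R[i]) : R[i] :=
  (expR (complex.Re z))%:C * (cos (complex.Im z) +i* sin (complex.Im z)).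
Definition coshC {R : realType} (z : R[i]) : R[i] := (expC z + expC (- z)) / 2.
Definition sinhC {R : realType} (z : R[i]) : R[i] := (expC z - expC (- z)) / 2.
Definition tanhC {R : realType} (z : R[i]) : R[i] := sinhC z / coshC z.

Section TwistKnot.
Context {R : realType}.

Definition point3 (x y z : R) : 'rV[R]_3 := \row_i [:: x; y; z]`_i.

Definition segment (p q : 'rV[R]_3) : set 'rV[R]_3 :=
  [set (1 - x) *: p + x *: q | x in `[0, 1]].

Fixpoint polyline (p : 'rV[R]_3) (s : seq 'rV[R]_3) : set 'rV[R]_3 :=
  if s is q :: s' then segment p q `|` polyline q s' else set0.

Definition helix (n : int) (c : R) : set 'rV[R]_3 :=
  [set point3 (c * cos (2 * pi * n%:~R * x)) (c * sin (2 * pi * n%:~R * x)) x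
  | x in `[0, 1]].

(* T_{2n}: the two helices make 2n half-twists about the vertical axis.
   Their upper ends (+-1, 0, 1) are joined by a hook in the plane y = 0, their
   lower ends (+-1, 0, 0) by a hook containing a U-turn in the plane x = 3; the
   two hooks are clasped, the lower one passing through (3, 0, 2), inside the
   upper one.  Reflecting the lower hook in the plane y = 0 would give the
   opposite clasp: with the choice made here T_2 is the figure-eight knot, T_{-2}
   the trefoil, and T_{2n} has determinant |4n + 1|. *)
Definition twist_knot3 (n : int) : set 'rV[R]_3 :=
  helix n 1 `|` helix n (- 1)
  `|` polyline (point3 1 0 1)
        [:: point3 1 0 3; point3 2 0 3; point3 2 0 1; point3 4 0 1;
            point3 4 0 4; point3 (- 1) 0 4; point3 (- 1) 0 1]
  `|` polyline (point3 (- 1) 0 0)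
        [:: point3 (- 1) 0 (- 2); point3 3 1 (- 2); point3 3 1 2;
            point3 3 (- 1) 2; point3 3 (- 1) (- 1); point3 1 0 (- 1);
            point3 1 0 0].

Definition sphere3 : set 'rV[R]_4 := [set p | \sum_i p ord0 i ^+ 2 = 1].

(* Inverse stereographic projection from the north pole. *)
Definition stereo (p : 'rV[R]_3) : 'rV[R]_4 :=
  let q := \sum_i p ord0 i ^+ 2 in
  row_mx ((2 / (q + 1)) *: p) (const_mx ((q - 1) / (q + 1)) : 'rV[R]_1).

Definition twist_knot (n : int) : set 'rV[R]_4 := stereo @` twist_knot3 n.

Definition knot_exterior (n : int) : set 'rV[R]_4 := sphere3 `\` twist_knot n.

End TwistKnot.

Section FundamentalGroup.
Context {R : realType}.
Implicit Types (X K : set 'rV[R]_4) (p q : R -> 'rV[R]_4).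

(* Only the restriction of a path to [0, 1] matters. *)
Definition is_path X p : Prop :=
  {within `[0, 1], continuous p} /\ p @` `[0, 1] `<=` X.

Definition is_loop X (x0 : 'rV[R]_4) p : Prop :=
  [/\ is_path X p, p 0 = x0 & p 1 = x0].

Definition path_cat p q : R -> 'rV[R]_4 :=
  fun x => if x <= 1 / 2 then p (2 * x) else q (2 * x - 1).

Definition path_rev p : R -> 'rV[R]_4 := fun x => p (1 - x).

Definition path_homotopic X p q : Prop :=
  exists H : R * R -> 'rV[R]_4,
  [/\ {within `[0, 1] `*` `[0, 1], continuous H},
      H @` (`[0, 1] `*` `[0, 1]) `<=` X &
      forall x, x \in `[0, 1] ->
        [/\ H (0, x) = p x, H (1, x) = q x, H (x, 0) = p 0 & H (x, 1) = p 1]].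

(* G, with cls sending a loop to its class, is the fundamental group of X
   based at x0. *)
Record fundamental_group X (x0 : 'rV[R]_4) (G : groupType)
    (cls : (R -> 'rV[R]_4) -> G) : Prop := {
  pi1_surj : forall g, exists2 p, is_loop X x0 p & cls p = g;
  pi1_eq : forall p q, is_loop X x0 p -> is_loop X x0 q ->
    cls p = cls q <-> path_homotopic X p q;
  pi1_mul : forall p q, is_loop X x0 p -> is_loop X x0 q ->
    cls (path_cat p q) = (cls p * cls q)%g }.

Definition solid_cylinder : set (R * R * R) :=
  [set u | u.1.1 ^+ 2 + u.1.2 ^+ 2 <= 1 /\ -1 <= u.2 <= 1].

(* g is represented by a path p to the boundary of a small disc which crosses K
   once, transversally, followed by that boundary and by p reversed; the disc is
   the middle section of a solid cylinder embedded so that its core is the part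
   of K that it contains. *)
Definition is_meridian K (x0 : 'rV[R]_4) (G : groupType)
    (cls : (R -> 'rV[R]_4) -> G) (g : G) : Prop :=
  exists phi : R * R * R -> 'rV[R]_4,
  [/\ {within solid_cylinder, continuous phi},
      {in solid_cylinder &, injective phi},
      phi @` solid_cylinder `<=` sphere3,
      forall u, solid_cylinder u -> K (phi u) <-> u.1 = (0, 0) &
      exists p, [/\ is_path (sphere3 `\` K) p, p 0 = x0, p 1 = phi (1, 0, 0) &
        g = cls (path_cat
              (path_cat p
                 (fun x => phi (cos (2 * pi * x), sin (2 * pi * x), 0)))
              (path_rev p))]].

End FundamentalGroup.

Section KnotGroup.

Definition expgz (G : groupType) (g : G) (n : int) : G :=
  match n with Posz k => (g ^+ k)%g | Negz k => (g ^- k.+1)%g end.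

Definition word_w (n : int) (G : groupType) (s t : G) : G :=
  expgz (t * s^-1 * t^-1 * s)%g n.

Definition word_w_star (n : int) (G : groupType) (s t : G) : G :=
  expgz (s * t^-1 * s^-1 * t)%g n.

Definition longitude (n : int) (G : groupType) (s t : G) : G :=
  (word_w_star n s t * word_w n s t)%g.

Definition twist_relation (n : int) (G : groupType) (s t : G) : Prop :=
  (s * word_w n s t * t^-1 * (word_w n s t)^-1 = 1)%g.

(* G = < s, t | s w t^-1 w^-1 = 1 >, by the universal property. *)
Definition twist_presentation (n : int) (G : groupType) (s t : G) : Prop :=
  twist_relation n s t /\
  forall (H : groupType) (a b : H),
    (twist_relation n a b ->
       exists f : {multiplicative G -> H}, f s = a /\ f t = b) /\
    (forall f g : {multiplicative G -> H}, f s = g s -> f t = g t -> f =1 g).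

End KnotGroup.

Inductive geometry := Hyperbolic | Euclidean | Spherical.

Section ConeManifold.
Context {R : realType}.

(* The model cone of angle alpha <= pi and constant curvature -1, 0 or 1, in
   cylindrical coordinates (r, theta, z) about its axis r = 0: theta is an
   angle modulo alpha. *)
Definition cone_coord (k : geometry) (alpha : R) (u : R * R * R) : Prop :=
  [/\ 0 <= u.1.1, k = Spherical -> u.1.1 < pi / 2 & 0 <= u.1.2 < alpha].

Definition angle_gap (alpha x y : R) : R :=
  Num.min `|x - y| (alpha - `|x - y|).

Definition cone_dist (k : geometry) (alpha : R) (u v : R * R * R) : R :=
  let: (r1, x1, z1) := u in
  let: (r2, x2, z2) := v in
  let c := cos (angle_gap alpha x1 x2) in
  match k with
  | Hyperbolic =>
      arcosh (cosh r1 * cosh r2 * cosh (z1 - z2) - sinh r1 * sinh r2 * c)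
  | Euclidean =>
      Num.sqrt (r1 ^+ 2 + r2 ^+ 2 - 2 * r1 * r2 * c + (z1 - z2) ^+ 2)
  | Spherical =>
      acos (cos r1 * cos r2 * cos (z1 - z2) + sin r1 * sin r2 * c)
  end.

Definition dball (d : 'rV[R]_4 -> 'rV[R]_4 -> R) (x : 'rV[R]_4) (e : R) :
  set 'rV[R]_4 := [set y | sphere3 y /\ d x y < e].

(* d is the path metric of a cone-manifold of geometry k with underlying space
   S^3, singular set K and cone-angle alpha along K.  The points of K and the
   regular points are treated together, since the model cone is an ordinary
   space form away from its axis.  As S^3 is compact, existence of midpoints
   says that d is a path metric. *)
Record cone_manifold (k : geometry) (K : set 'rV[R]_4) (alpha : R)
    (d : 'rV[R]_4 -> 'rV[R]_4 -> R) : Prop := {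
  cone_eq0 : forall x y, sphere3 x -> sphere3 y -> d x y = 0 <-> x = y;
  cone_sym : forall x y, sphere3 x -> sphere3 y -> d x y = d y x;
  cone_triangle : forall x y z, sphere3 x -> sphere3 y -> sphere3 z ->
    d x z <= d x y + d y z;
  cone_midpoint : forall x y, sphere3 x -> sphere3 y ->
    exists m, [/\ sphere3 m, d x m = d x y / 2 & d m y = d x y / 2];
  cone_topology : forall x, sphere3 x -> forall A : set 'rV[R]_4,
    within sphere3 (nbhs x) A <-> exists2 e : R, 0 < e & dball d x e `<=` A;
  cone_chart : forall x, sphere3 x ->
    exists (e : R) (phi : 'rV[R]_4 -> R * R * R),
    [/\ 0 < e,
        forall y, dball d x e y -> cone_coord k alpha (phi y),
        forall y z, dball d x e y -> dball d x e z ->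
          d y z = cone_dist k alpha (phi y) (phi z),
        forall y, dball d x e y -> K y <-> (phi y).1.1 = 0 &
        forall u, cone_coord k alpha u -> cone_dist k alpha (phi x) u < e ->
          exists2 y, dball d x e y & cone_dist k alpha (phi y) u = 0] }.

Definition has_geometry (k : geometry) (n : int) (alpha : R) : Prop :=
  exists d, cone_manifold k (twist_knot n) alpha d.

Definition transition_angle (n : int) (alpha0 : R) : Prop :=
  [/\ 2 * pi / 3 <= alpha0 < pi,
      forall alpha, 0 < alpha < alpha0 -> has_geometry Hyperbolic n alpha,
      has_geometry Euclidean n alpha0 &
      forall alpha, alpha0 < alpha <= pi -> has_geometry Spherical n alpha].

End ConeManifold.

Section Holonomy.
Context {R : realType}.

(* H^3 is the set of positive definite Hermitian 2 x 2 matrices of determinant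
   1, on which SL(2, C) acts by orientation-preserving isometries
   X |-> A X A^*, the kernel being {1, -1}.  On the sphere at infinity
   (matrices v v^* of rank one) this is the Moebius action of A on the point v of
   CP^1. *)
Definition adjmx (A : 'M[R[i]]_2) : 'M[R[i]]_2 := map_mx (@conjc R) A^T.

Definition hyperbolic3 : set 'M[R[i]]_2 :=
  [set X | [/\ adjmx X = X, \det X = 1 & 0 < \tr X]].

Definition hyperbolic_act (A X : 'M[R[i]]_2) : 'M[R[i]]_2 :=
  A *m X *m adjmx A.

(* cosh d(X, Y) = tr (X Y^-1) / 2. *)
Definition hyperbolic_dist (X Y : 'M[R[i]]_2) : R :=
  arcosh (complex.Re (\tr (X *m invmx Y)) / 2).

(* A developing map of the hyperbolic structure given by d on X.  The universal
   cover of X is the set of homotopy classes of paths issued from x0; a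
   neighbourhood of the class of p consists of the classes of path_cat p q for q
   in a small ball about the endpoint of p. *)
Record developing_map (X : set 'rV[R]_4) (d : 'rV[R]_4 -> 'rV[R]_4 -> R)
    (x0 : 'rV[R]_4) (D : (R -> 'rV[R]_4) -> 'M[R[i]]_2) : Prop := {
  dev_hyperbolic3 : forall p, is_path X p -> p 0 = x0 -> hyperbolic3 (D p);
  dev_homotopic : forall p q, is_path X p -> is_path X q ->
    p 0 = x0 -> q 0 = x0 -> path_homotopic X p q -> D p = D q;
  dev_isometry : forall p, is_path X p -> p 0 = x0 ->
    exists2 e : R, 0 < e & forall q1 q2,
      is_path (X `&` dball d (p 1) e) q1 -> is_path (X `&` dball d (p 1) e) q2 ->
      q1 0 = p 1 -> q2 0 = p 1 ->
      hyperbolic_dist (D (path_cat p q1)) (D (path_cat p q2))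
        = d (q1 1) (q2 1) }.

Definition is_holonomy_lift (X : set 'rV[R]_4)
    (d : 'rV[R]_4 -> 'rV[R]_4 -> R) (x0 : 'rV[R]_4)
    (G : groupType) (cls : (R -> 'rV[R]_4) -> G) (eta : G -> 'M[R[i]]_2) : Prop :=
  [/\ forall g, \det (eta g) = 1,
      forall g h, eta (g * h)%g = eta g *m eta h &
      exists2 D, developing_map X d x0 D &
        forall g p, is_loop X x0 g -> is_path X p -> p 0 = x0 ->
          D (path_cat g p) = hyperbolic_act (eta (cls g)) (D p)].

(* An oriented line of H^3 is given by homogeneous coordinates of its initial
   and final endpoints in CP^1. *)
Definition oriented_line : Type := ('cV[R[i]]_2 * 'cV[R[i]]_2)%type.

Definition point_CP1 (z : R[i]) : 'cV[R[i]]_2 := \col_i [:: z; 1]`_i.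

Definition same_point (v w : 'cV[R[i]]_2) : Prop :=
  exists2 c, c != 0 & w = c *: v.

Definition diag2 (a b : R[i]) : 'M[R[i]]_2 := diag_mx (\row_i [:: a; b]`_i).

Definition line_image (A : 'M[R[i]]_2) (L L' : oriented_line) : Prop :=
  same_point (A *m L.1) L'.1 /\ same_point (A *m L.2) L'.2.

(* L is the axis of the elliptic M, so oriented that M is the right-handed
   rotation about it through the angle alpha: the fixed point with eigenvalue
   e^{i alpha / 2} is the final endpoint, as for the axis from 0 to infinity of
   diag(e^{i alpha / 2}, e^{- i alpha / 2}). *)
Definition rotation_axis (alpha : R) (M : 'M[R[i]]_2) (L : oriented_line) :
    Prop :=
  [/\ L.1 != 0, L.2 != 0,
      M *m L.1 = expC (- ('i%C * (alpha / 2)%:C)) *: L.1 &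
      M *m L.2 = expC ('i%C * (alpha / 2)%:C) *: L.2].

(* The line from -1 to 1 is orthogonal to the line from 0 to infinity, along
   which diag(e^{rho / 2}, e^{- rho / 2}) is the screw motion of translation
   length Re rho and rotation angle Im rho.  Hence L1 and L2 have a common
   perpendicular (the image under A of the latter line), and the screw motion of
   complex length rho along it takes L1 to L2. *)
Definition complex_distance (L1 L2 : oriented_line) (rho : R[i]) : Prop :=
  exists A : 'M[R[i]]_2,
  [/\ \det A = 1,
      line_image A (point_CP1 (- 1), point_CP1 1) L1 &
      line_image (A *m diag2 (expC (rho / 2)) (expC (- (rho / 2))))
        (point_CP1 (- 1), point_CP1 1) L2].

Definition longitude_length (alpha : R) (T L : 'M[R[i]]_2) (gamma : R[i]) :
    Prop :=
  exists P : 'M[R[i]]_2,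
  [/\ P \in unitmx,
      P *m T *m invmx P
        = diag2 (expC ('i%C * (alpha / 2)%:C)) (expC (- ('i%C * (alpha / 2)%:C))) &
      P *m L *m invmx P = diag2 (expC (gamma / 2)) (expC (- (gamma / 2)))].

End Holonomy.

(* Main.v *)
Require Import Defs.
From HB Require Import structures.
From mathcomp Require Import all_boot all_order all_algebra.
From mathcomp Require Import complex ring lra.
From mathcomp Require Import all_classical all_reals all_analysis.

(** Write c = cos (alpha / 2), sg = i sin (alpha / 2) and e = exp (rho / 2).  In
    a basis adapted to the common perpendicular of the two axes, the meridians
    become the matrices S = [c, sg / e; sg e, c] and T = [c, sg e; sg / e, c]
    ([complex_distance_normal_form]).  They are exchanged both by transposition
    and by conjugation by the swap J of the two coordinates.

    Let M be the image of t s^-1 t^-1 s, and W = M^n that of w.  M is symmetric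
    by the first symmetry, hence so is W.  By the second one w* goes to J W J,
    so that the longitude goes to (J W)^2.  For symmetric W the relation
    S W = W T says that W = [a, b; b, e^2 a], which makes (e, 1), the
    eigenvector of T for the eigenvalue c + sg, an eigenvector of J W as well,
    for the eigenvalue x + b where x = e a.  As det W = 1 means x^2 - b^2 = 1, up to a common sign
    x = cosh (gamma / 4) and b = sinh (gamma / 4)
    ([twist_longitude_eigenvector]).

    One more equation relates x, b and rho: being a power of M, W commutes with
    M, and this gives
      b (c^2 - sg^2 cosh rho) = sg c x (cosh rho - 1),
    in which n has disappeared ([pythagorean_normal_form]).  So
      tanh (gamma / 4) = sg c (cosh rho - 1) / (c^2 - sg^2 cosh rho),
    and the addition formula for tanh yields the theorem; [tanh_shift] does
    this last computation without dividing by x or by c^2 - sg^2 cosh rho, so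
    that their zeros need no separate treatment. *)

Set Implicit Arguments.
Unset Strict Implicit.
Unset Printing Implicit Defensive.

Import Order.TTheory GRing.Theory Num.Theory.
Import numFieldNormedType.Exports.

Local Open Scope ring_scope.
Local Open Scope complex_scope.

(** * Two-by-two matrices *)

Definition mx2 {F : fieldType} (a b c d : F) : 'M[F]_2 :=
  \matrix_(i, j) [:: [:: a; b]`_j; [:: c; d]`_j]`_i.

Definition col2 {F : fieldType} (x y : F) : 'cV[F]_2 := \col_i [:: x; y]`_i.

Section Matrices.
Variable F : fieldType.
Implicit Types a b c d : F.

Lemma ord2E (i : 'I_2) : (i = 0) \/ (i = 1).
Proof. by case: i => [[|[|]]] // ?; [left|right]; apply: val_inj. Qed.

Lemma mx2_eta (A : 'M[F]_2) : A = mx2 (A 0 0) (A 0 1) (A 1 0) (A 1 1).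
Proof.
by apply/matrixP => i j; rewrite !mxE; case: (ord2E i) (ord2E j) => -> [] ->.
Qed.

Lemma mx2_inj a b c d a' b' c' d' : mx2 a b c d = mx2 a' b' c' d' ->
  [/\ a = a', b = b', c = c' & d = d'].
Proof.
by move=> /matrixP h; split;
  [move: (h 0 0)|move: (h 0 1)|move: (h 1 0)|move: (h 1 1)]; rewrite !mxE.
Qed.

Lemma mx2M a b c d a' b' c' d' : mx2 a b c d * mx2 a' b' c' d' =
  mx2 (a * a' + b * c') (a * b' + b * d') (c * a' + d * c') (c * b' + d * d').
Proof.
apply/matrixP => i j; rewrite !mxE !big_ord_recl big_ord0 !mxE addr0.
by case: (ord2E i) (ord2E j) => -> [] ->.
Qed.

Lemma mx2_1 : 1 = mx2 1 0 0 1 :> 'M[F]_2.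
Proof. by rewrite (mx2_eta 1) !mxE. Qed.

Lemma mx2_tr a b c d : (mx2 a b c d)^T = mx2 a c b d.
Proof. by rewrite (mx2_eta (_ ^T)) !mxE. Qed.

Lemma det_mx2 a b c d : \det (mx2 a b c d) = a * d - b * c.
Proof.
rewrite (expand_det_row _ 0) !big_ord_recl big_ord0 addr0 /cofactor !det_mx11.
by rewrite !mxE /= expr0 expr1; ring.
Qed.

Lemma unit_mx2 a b c d : a * d - b * c != 0 -> mx2 a b c d \is a GRing.unit.
Proof.
move=> h; have : mx2 a b c d \in unitmx by rewrite unitmxE det_mx2 unitfE.
by [].
Qed.

Lemma mx2V a b c d :
  a * d - b * c = 1 -> (mx2 a b c d)^-1 = mx2 d (- b) (- c) a.
Proof.
move=> h; have U : mx2 a b c d \is a GRing.unit.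
  by apply: unit_mx2; rewrite h oner_eq0.
rewrite -[RHS](mulKr U) mx2M -[LHS]mulr1 mx2_1 -h; congr (_ * mx2 _ _ _ _).
all: ring.
Qed.

Lemma col2_inj a b a' b' : col2 a b = col2 a' b' -> a = a' /\ b = b'.
Proof.
by move=> /matrixP h; split; [move: (h 0 0)|move: (h 1 0)]; rewrite !mxE.
Qed.

Lemma scale_col2 a x y : a *: col2 x y = col2 (a * x) (a * y).
Proof. by apply/matrixP => i j; rewrite !mxE; case: (ord2E i) => ->. Qed.

Lemma mx2_col a b c d x y :
  mx2 a b c d *m col2 x y =
  col2 (a * x + b * y) (c * x + d * y).
Proof.
apply/matrixP => i j; rewrite !mxE !big_ord_recl big_ord0 !mxE addr0.
by case: (ord2E i) => ->.
Qed.

End Matrices.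

Lemma conjr_exprz (A : unitRingType) (P M : A) (n : int) :
    P \is a GRing.unit -> M \is a GRing.unit ->
  (P^-1 * M * P) ^ n = P^-1 * M ^ n * P.
Proof.
move=> uP uM; have H k : (P^-1 * M * P) ^+ k = P^-1 * M ^+ k * P.
  elim: k => [|k IH]; first by rewrite !expr0 mulr1 mulVr.
  by rewrite !exprSr IH !mulrA mulrK.
case: n => k; first exact: H.
rewrite /exprz H; have uMk := unitrX k.+1 uM.
by rewrite invrM ?unitrMr ?unitrV // invrM ?unitrV // invrK mulrA.
Qed.

Lemma trmx_exprz (F : fieldType) (M : 'M[F]_2) (n : int) :
  (M ^ n)^T = M^T ^ n.
Proof.
have H k : (M ^+ k)^T = M^T ^+ k.
  elim: k => [|k IH]; first by rewrite !expr0 trmx1.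
  rewrite exprS exprSr -IH; exact: trmx_mul.
by case: n => k; rewrite /exprz -?H //; exact: trmx_inv.
Qed.

Definition swap {F : fieldType} : 'M[F]_2 := mx2 0 1 1 0.

Lemma swap_unit (F : fieldType) : swap \is a @GRing.unit 'M[F]_2.
Proof. by apply: unit_mx2; rewrite mul0r mul1r sub0r oppr_eq0 oner_eq0. Qed.

Lemma swapV (F : fieldType) : swap^-1 = swap :> 'M[F]_2.
Proof.
have h : swap * swap = 1 :> 'M[F]_2.
  by rewrite mx2M mx2_1; congr mx2; ring.
by rewrite -[LHS]mulr1 -h mulKr // swap_unit.
Qed.

(** * Twist knot words in meridians in normal form *)

Section Riley.
Variables (F : numFieldType) (c sg e : F).
Hypotheses (unim : c ^+ 2 - sg ^+ 2 = 1) (e_neq0 : e != 0) (sg_neq0 : sg != 0).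

(** Both are conjugates of [c, sg; sg, c], the rotation about the line from -1
    to 1: by diag (1, e) and by diag (e, 1) respectively. *)
Definition normalS : 'M[F]_2 := mx2 c (sg / e) (sg * e) c.
Definition normalT : 'M[F]_2 := mx2 c (sg * e) (sg / e) c.
Local Notation S := normalS.
Local Notation T := normalT.

Lemma normalSV : S^-1 = mx2 c (- (sg / e)) (- (sg * e)) c.
Proof. by apply: mx2V; rewrite -unim; field. Qed.

Lemma normalTV : T^-1 = mx2 c (- (sg * e)) (- (sg / e)) c.
Proof. by apply: mx2V; rewrite -unim; field. Qed.

Lemma normalS_unit : S \is a GRing.unit.
Proof.
by apply: unit_mx2; rewrite (_ : _ - _ = 1) ?oner_eq0 // -unim; field.
Qed.

Lemma normalT_unit : T \is a GRing.unit.
Proof.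
by apply: unit_mx2; rewrite (_ : _ - _ = 1) ?oner_eq0 // -unim; field.
Qed.

(** With [root_w_star], the words whose n-th powers are w and w*. *)
Definition root_w : 'M[F]_2 := T * S^-1 * T^-1 * S.
Definition root_w_star : 'M[F]_2 := S * T^-1 * S^-1 * T.

Lemma root_w_unit : root_w \is a GRing.unit.
Proof. by rewrite !unitrMl ?unitrV ?normalS_unit ?normalT_unit. Qed.

Lemma root_wE (k := c * sg * (e - e^-1)) (A := c ^+ 2 - sg ^+ 2 * e ^+ 2)
    (B := c ^+ 2 - sg ^+ 2 / e ^+ 2) :
  root_w = mx2 (A ^+ 2 + k ^+ 2) (k * (B - A)) (k * (B - A)) (B ^+ 2 + k ^+ 2).
Proof.
by rewrite /root_w normalSV normalTV !mx2M /A /B /k; congr mx2; field.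
Qed.

Lemma trmx_root_w : root_w^T = root_w.
Proof. by rewrite root_wE mx2_tr. Qed.

(** Conjugation by [swap] exchanges the two meridians. *)
Lemma root_w_starE : root_w_star = swap^-1 * root_w * swap.
Proof.
rewrite /root_w_star /root_w normalSV normalTV swapV !mx2M; congr mx2; ring.
Qed.

(** [e ^+ 4 = 1] is the case of commuting meridians, and then the commutator
    [root_w] is trivial. *)
Lemma commuting_meridians_root_w : e ^+ 4 = 1 -> root_w = 1.
Proof.
move=> e4; have ST : S * T = T * S.
  have eV2 : e^-1 ^+ 2 = e ^+ 2.
    rewrite exprVn; apply: (mulfI (expf_neq0 2 e_neq0)).
    by rewrite divff ?expf_neq0 // -exprD e4.
  have sgV : sg / e * (sg / e) = sg * e * (sg * e).
    by rewrite mulrACA -(expr2 e^-1) eV2; ring.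
  by rewrite !mx2M sgV; congr mx2; ring.
have -> : root_w = T * (S^-1 * T^-1) * S by rewrite /root_w !mulrA.
have U := (normalS_unit, normalT_unit).
by rewrite -invrM ?U // -ST invrM ?U // mulrA mulrV ?U // mul1r mulVr ?U.
Qed.

(** Comparing the off-diagonal entries of the two products gives twice the
    conclusion multiplied by the difference B - A of the quantities in
    [root_wE], which is a nonzero multiple of [e ^+ 4 - 1]. *)
Lemma commuting_with_root_w a b d (h := (e ^+ 2 + e ^- 2) / 2) :
    d = e ^+ 2 * a -> e ^+ 4 != 1 -> GRing.comm (mx2 a b b d) root_w ->
  b * (c ^+ 2 - sg ^+ 2 * h) = sg * c * (e * a) * (h - 1).
Proof.
move=> -> e4; rewrite /GRing.comm root_wE !mx2M => /mx2_inj[_ H _ _].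
set k := c * sg * (e - e^-1) in H.
set A := c ^+ 2 - sg ^+ 2 * e ^+ 2 in H.
set B := c ^+ 2 - sg ^+ 2 / e ^+ 2 in H.
have BA_neq0 : B - A != 0.
  have -> : B - A = sg ^+ 2 / e ^+ 2 * (e ^+ 4 - 1) by rewrite /A /B; field.
  by rewrite !mulf_neq0 ?invr_eq0 ?expf_neq0 // subr_eq0.
have {}H : (B - A) * (k * (a - e ^+ 2 * a) + b * (A + B)) = 0.
  by move/eqP: H; rewrite -subr_eq0 => /eqP <-; ring.
move/eqP: H; rewrite mulf_eq0 (negPf BA_neq0) /= => /eqP H.
apply/eqP; rewrite -subr_eq0; apply/eqP; rewrite -[RHS](mul0r 2^-1) -H.
by rewrite /A /B /k /h; field.
Qed.

(** In the last equation [h] is [cosh rho] when [e = exp (rho / 2)]; the sign of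
    the exponent does not matter.  If [e ^+ 4 = 1] then commutation of
    [root_w ^ n] with [root_w] is void, but then [root_w = 1] and the
    relation says that the meridians are equal: [e ^+ 2 = 1], and both sides
    vanish. *)
Lemma pythagorean_normal_form (n : int) (h := (e ^+ 2 + e ^- 2) / 2) :
    S * root_w ^ n = root_w ^ n * T -> \det (root_w ^ n) = 1 ->
  exists a b, [/\ root_w ^ n = mx2 a b b (e ^+ 2 * a),
    (e * a) ^+ 2 - b ^+ 2 = 1 &
    b * (c ^+ 2 - sg ^+ 2 * h) = sg * c * (e * a) * (h - 1)].
Proof.
move=> rel det1; set W : 'M[F]_2 := root_w ^ n in rel det1 *.
have symW : W^T = W by rewrite trmx_exprz trmx_root_w.
have WE : W = mx2 (W 0 0) (W 0 1) (W 0 1) (W 1 1).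
  by rewrite {1}(mx2_eta W) -{3}symW mxE.
have dE : W 1 1 = e ^+ 2 * W 0 0.
  move: rel; rewrite {1 2}WE !mx2M => /mx2_inj[_ /eqP + _ _].
  rewrite -subr_eq0 => /eqP H; apply/eqP; rewrite -subr_eq0; apply/eqP.
  by apply: (mulfI sg_neq0); rewrite mulr0 -(mulr0 e) -H; field.
rewrite dE in WE; exists (W 0 0), (W 0 1); split=> //.
  by rewrite -[RHS]det1 WE det_mx2 !mxE /=; ring.
have [e4|e4] := eqVneq (e ^+ 4) 1; last first.
  apply: (commuting_with_root_w (erefl _)) => //.
  by rewrite -WE; apply/commr_sym/commrXz.
have W1 : W = 1 by rewrite /W commuting_meridians_root_w // exp1rz.
have e2 : e ^+ 2 = 1 by move: dE; rewrite W1 !mxE /= mulr1.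
by rewrite W1 !mxE /= /h e2 invr1; field.
Qed.

(** The product is [(swap * root_w ^ n) ^+ 2], and [swap * root_w ^ n]
    multiplies the vector by [e * a + b]. *)
Lemma longitude_eigenvector (n : int) a b :
    root_w ^ n = mx2 a b b (e ^+ 2 * a) ->
  (root_w_star ^ n * root_w ^ n) *m col2 e 1
    = (e * a + b) ^+ 2 *: col2 e 1.
Proof.
move=> WE; rewrite root_w_starE conjr_exprz ?swap_unit ?root_w_unit //.
rewrite swapV WE !mx2M mx2_col.
by rewrite scale_col2; congr col2; ring.
Qed.
End Riley.

(** * Putting rotations in normal form *)

Section NormalForm.
Variables (F : numFieldType) (c sg : F).

Lemma rotation_normal_form (A M : 'M[F]_2) : A \is a GRing.unit ->
    M *m (A *m col2 (-1) 1) = (c - sg) *: (A *m col2 (-1) 1) ->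
    M *m (A *m col2 1 1) = (c + sg) *: (A *m col2 1 1) ->
  A^-1 * M * A = mx2 c sg sg c.
Proof.
move=> uA h1 h2; set N : 'M[F]_2 := A^-1 * M * A.
have eig (x : 'cV[F]_2) l : M *m (A *m x) = l *: (A *m x) -> N *m x = l *: x.
  move=> h; rewrite -[RHS]mul1mx -scalemxAr.
  rewrite -[X in l *: (X *m _)](mulVr uA).
  by rewrite -[in RHS]mulmxA scalemxAr -h !mulmxA.
have {}h1 := eig _ _ h1.
have {}h2 := eig _ _ h2.
move: h1 h2; rewrite (mx2_eta N) !mx2_col !scale_col2.
move: (N 0 0) (N 0 1) (N 1 0) (N 1 1) => x y z w.
move=> /col2_inj[e1 e2] /col2_inj[e3 e4].
have two_neq0 : 2 != 0 :> F by rewrite pnatr_eq0.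
congr mx2; apply: (mulfI two_neq0).
- by transitivity (x * 1 + y * 1 - (x * -1 + y * 1)); [ring|rewrite e1 e3; ring].
- by transitivity (x * 1 + y * 1 + (x * -1 + y * 1)); [ring|rewrite e1 e3; ring].
- by transitivity (z * 1 + w * 1 - (z * -1 + w * 1)); [ring|rewrite e2 e4; ring].
- by transitivity (z * 1 + w * 1 + (z * -1 + w * 1)); [ring|rewrite e2 e4; ring].
Qed.

Lemma dilated_normal_form (x y : F) (A M : 'M[F]_2) : x != 0 -> y != 0 ->
    A \is a GRing.unit -> A^-1 * M * A = mx2 c sg sg c ->
  (A * mx2 x 0 0 y)^-1 * M * (A * mx2 x 0 0 y) = normalS c sg (x / y).
Proof.
move=> x0 y0 uA h; have uD : mx2 x 0 0 y \is a @GRing.unit 'M[F]_2.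
  by apply: unit_mx2; rewrite mulr0 subr0 mulf_neq0.
rewrite invrM // !mulrA -(mulrA _ A^-1) -(mulrA _ _ A) h.
apply: (mulrI uD); rewrite !mulrA mulrV // mul1r /normalS !mx2M.
by congr mx2; field; rewrite ?x0 ?y0.
Qed.
End NormalForm.

(** * The complex exponential *)

Section ComplexExponential.
Variable R : realType.
Implicit Types z w : R[i].

Lemma expCD z w : expC (z + w) = expC z * expC w.
Proof.
case: z w => [x y] [x' y']; rewrite /expC /= expRD cosD sinD.
by apply/eqP; rewrite eq_complex /=; apply/andP; split; apply/eqP; ring.
Qed.

Lemma expC0 : expC (0 : R[i]) = 1.
Proof. by rewrite /expC /= expR0 cos0 sin0 mul1r. Qed.

Lemma expCN z : expC (- z) = (expC z)^-1.
Proof.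
have h : expC z * expC (- z) = 1 by rewrite -expCD subrr expC0.
by rewrite (mulr1_eq h).
Qed.

Lemma expC_neq0 z : expC z != 0.
Proof.
apply/eqP => h; have := expCD z (- z).
by rewrite subrr expC0 h mul0r => /eqP; rewrite oner_eq0.
Qed.

Lemma expC_half z : expC z = expC (z / 2) ^+ 2.
Proof. by rewrite expr2 -expCD -splitr. Qed.

Lemma expC_i (x : R) :
  expC ('i%C * x%:C) = (cos x)%:C + 'i%C * (sin x)%:C.
Proof.
rewrite /expC /= !(mul0r, mulr0, mul1r) subrr add0r expR0 mul1r.
apply/eqP; rewrite eq_complex /=.
by rewrite !(mul0r, mulr0, mul1r, subr0, addr0, add0r) !eqxx.
Qed.

Lemma expC_Ni (x : R) :
  expC (- ('i%C * x%:C)) = (cos x)%:C - 'i%C * (sin x)%:C.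
Proof. by rewrite -mulrN -rmorphN expC_i cosN sinN rmorphN mulrN. Qed.

End ComplexExponential.

(** * Representations of the twist knot group in SL(2) *)

Lemma unit_det1 (F : fieldType) (A : 'M[F]_2) :
  \det A = 1 -> A \is a GRing.unit.
Proof.
by move=> h; have : A \in unitmx by rewrite unitmxE h unitr1.
Qed.

Section SL2Representation.
Variables (F : fieldType) (G : groupType) (eta : G -> 'M[F]_2).
Hypotheses (det_eta : forall g, \det (eta g) = 1)
  (etaM : forall g h, eta (g * h)%g = eta g *m eta h).

Lemma SL2_repr1 : eta 1%g = 1.
Proof.
apply: (mulrI (unit_det1 (det_eta 1%g))).
by rewrite mulr1; have /esym := etaM 1%g 1%g; rewrite mulg1.
Qed.

Lemma SL2_reprV g : eta g^-1%g = (eta g)^-1.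
Proof.
apply: (mulrI (unit_det1 (det_eta g))); rewrite mulrV ?unit_det1 //.
by have /esym := etaM g g^-1%g; rewrite mulgV SL2_repr1.
Qed.

Lemma SL2_repr_expgz g (n : int) : eta (expgz g n) = eta g ^ n.
Proof.
have H k : eta (g ^+ k)%g = eta g ^+ k.
  elim: k => [|k IH]; first by rewrite expg0 SL2_repr1.
  by rewrite expgS etaM IH exprS.
by case: n => k /=; rewrite ?SL2_reprV H.
Qed.

Lemma conj_SL2_repr (Q : 'M[F]_2) (uQ : Q \is a GRing.unit)
    (theta := fun g => Q^-1 * eta g * Q) :
  (forall g, \det (theta g) = 1) /\
  (forall g h, theta (g * h)%g = theta g *m theta h).
Proof.
split=> [g|g h]; rewrite /theta.
  rewrite !det_mulmx det_eta mulr1 -det_mulmx.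
  by rewrite [X in \det X](mulVr uQ) det1.
by rewrite etaM -[RHS]/(_ * _) !mulrA mulrK.
Qed.
End SL2Representation.

(** Here [x + b] is the eigenvalue of a square root of the holonomy of the
    longitude, whence a common sign of [x = cosh (gamma / 4)] and
    [b = sinh (gamma / 4)] remains undetermined. *)
Lemma twist_longitude_eigenvector (F : numFieldType) (c sg e : F) (n : int)
    (G : groupType) (s t : G) (theta : G -> 'M[F]_2)
    (h := (e ^+ 2 + e ^- 2) / 2) :
    c ^+ 2 - sg ^+ 2 = 1 -> e != 0 -> sg != 0 ->
    (forall g, \det (theta g) = 1) ->
    (forall g g', theta (g * g')%g = theta g *m theta g') ->
    theta s = normalS c sg e -> theta t = normalT c sg e ->
    twist_relation n s t ->
  exists x b, [/\ x ^+ 2 - b ^+ 2 = 1,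
    b * (c ^+ 2 - sg ^+ 2 * h) = sg * c * x * (h - 1) &
    theta (longitude n s t) *m col2 e 1 = (x + b) ^+ 2 *: col2 e 1].
Proof.
move=> unim e0 sg0 det_theta thetaM thetas thetat rel.
have thetaV g := SL2_reprV det_theta thetaM g.
have thetaw : theta (word_w n s t) = root_w c sg e ^ n.
  by rewrite /word_w SL2_repr_expgz // !thetaM !thetaV thetas thetat.
have thetaw_star : theta (word_w_star n s t) = root_w_star c sg e ^ n.
  by rewrite /word_w_star SL2_repr_expgz // !thetaM !thetaV thetas thetat.
have sw_wt : (s * word_w n s t = word_w n s t * t)%g.
  by apply/eqP; rewrite -divg_eq; apply/eqP/divg1_eq.
have relW : normalS c sg e * root_w c sg e ^ n
    = root_w c sg e ^ n * normalT c sg e.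
  by rewrite -thetas -thetat -thetaw -[LHS]thetaM -[RHS]thetaM sw_wt.
have detW : \det (root_w c sg e ^ n) = 1 by rewrite -thetaw.
have [a [b [WE xb key]]] := pythagorean_normal_form unim e0 sg0 relW detW.
exists (e * a), b; split=> //.
by rewrite /longitude thetaM thetaw thetaw_star; exact: longitude_eigenvector.
Qed.

(** * Axes, complex distance and longitude length *)

Lemma diag2E (R : realType) (a b : R[i]) : diag2 a b = mx2 a 0 0 b.
Proof. by rewrite /diag2 (mx2_eta (diag_mx _)) !mxE. Qed.

Section Axes.
Variable R : realType.
Implicit Types (A M : 'M[R[i]]_2) (L : oriented_line (R := R)).

Lemma same_point_eigen A M (p v : 'cV[R[i]]_2) l :
  same_point (A *m p) v -> M *m v = l *: v -> M *m (A *m p) = l *: (A *m p).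
Proof.
case=> k k0 ->; rewrite -scalemxAr scalerA mulrC -scalerA.
by move/(scalerI k0).
Qed.

Lemma rotation_axis_normal_form alpha A M L : \det A = 1 ->
    line_image A (point_CP1 (- 1), point_CP1 1) L ->
    rotation_axis alpha M L ->
  let c := (cos (alpha / 2))%:C in let sg := 'i%C * (sin (alpha / 2))%:C in
  A^-1 * M * A = mx2 c sg sg c.
Proof.
move=> dA [h1 h2] [_ _ e1 e2] c sg.
apply: rotation_normal_form; first exact: unit_det1.
  by rewrite -expC_Ni; exact: same_point_eigen h1 e1.
by rewrite -expC_i; exact: same_point_eigen h2 e2.
Qed.

(** In the basis [A] sending the line from -1 to 1 to the axis of [S], the two
    meridians are a common rotation and its conjugate by diag (e, 1 / e).  The
    further change of basis diag (e, 1) = diag (e, 1 / e) diag (1, e) splits the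
    screw motion evenly between them. *)
Lemma complex_distance_normal_form alpha (S T : 'M[R[i]]_2) LS LT rho :
    rotation_axis alpha S LS -> rotation_axis alpha T LT ->
    complex_distance LS LT rho ->
  let c := (cos (alpha / 2))%:C in let sg := 'i%C * (sin (alpha / 2))%:C in
  let e := expC (rho / 2) in
  exists2 Q, Q \is a GRing.unit &
    Q^-1 * S * Q = normalS c sg e /\ Q^-1 * T * Q = normalT c sg e.
Proof.
move=> hS hT [A [dA imS imT]] c sg e.
have e0 : e != 0 by exact: expC_neq0.
have uA := unit_det1 dA.
have NS := rotation_axis_normal_form dA imS hS.
rewrite diag2E expCN -/e in imT.
have dAE : \det (A *m mx2 e 0 0 e^-1) = 1.
  by rewrite det_mulmx dA mul1r det_mx2 mulr0 subr0 divff.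
have NT := rotation_axis_normal_form dAE imT hT.
exists (A * mx2 e 0 0 1).
  by rewrite unitrMl //; apply: unit_mx2; rewrite mulr1 mulr0 subr0.
split.
  by rewrite -[e in RHS]divr1; apply: dilated_normal_form; rewrite ?oner_eq0.
have -> : A * mx2 e 0 0 1 = A *m mx2 e 0 0 e^-1 * mx2 1 0 0 e.
  by rewrite -[A *m _]/(A * _) -mulrA mx2M; congr (_ * mx2 _ _ _ _); field.
rewrite (dilated_normal_form (oner_neq0 _) e0 (unit_det1 dAE) NT).
rewrite /normalS /normalT.
by congr mx2; rewrite div1r ?invrK.
Qed.

(** As [sin (alpha / 2) != 0], the two eigenvalues of [T] are distinct: [v]
    spans the line on which [longitude_length] reads off [exp (gamma / 2)]. *)
Lemma longitude_length_eigen alpha (T L : 'M[R[i]]_2) (v : 'cV[R[i]]_2) m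
    gamma :
    sin (alpha / 2) != 0 ->
    T *m v = expC ('i%C * (alpha / 2)%:C) *: v -> L *m v = m *: v -> v != 0 ->
    longitude_length alpha T L gamma -> m = expC (gamma / 2).
Proof.
move=> s0 hT hL v0 [P [uP PT PL]].
have transport (M D : 'M[R[i]]_2) l : P *m M *m invmx P = D ->
    M *m v = l *: v -> D *m (P *m v) = l *: (P *m v).
  by move=> <- h; rewrite -!mulmxA mulKmx // h scalemxAr.
move: (transport _ _ _ PT hT) (transport _ _ _ PL hL).
have : P *m v != 0.
  by apply: contraNneq v0 => Pv0; rewrite -(mulKmx uP v) Pv0 mulmx0.
have -> : P *m v = col2 ((P *m v) 0 0) ((P *m v) 1 0).
  by apply/matrixP => i j; rewrite [RHS]mxE (ord1 j); case: (ord2E i) => ->.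
move: ((P *m v) 0 0) ((P *m v) 1 0) => x y xy0.
rewrite !diag2E !mx2_col !scale_col2 => /col2_inj[_ hy] /col2_inj[hx _].
have y0 : y = 0.
  have sg0 : 2 * ('i%C * (sin (alpha / 2))%:C) != 0 :> R[i].
    rewrite !mulf_neq0 ?pnatr_eq0 //; last by rewrite (inj_eq (@complexI _)).
    by rewrite eq_complex /= oner_eq0 andbF.
  apply: (mulfI sg0); rewrite mulr0.
  move: hy; rewrite expC_i expC_Ni => /eqP; rewrite eq_sym -subr_eq0 => /eqP <-.
  by ring.
have x0 : x != 0.
  apply: contraNneq xy0 => x0; rewrite x0 y0.
  by apply/eqP/matrixP => i j; rewrite !mxE; case: (ord2E i) => ->.
by apply: (mulIf x0); rewrite -hx; ring.
Qed.

End Axes.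

(** * The addition formula *)

(** With [E = exp (gamma / 4)] and [c + sg = exp (i alpha / 2)], the two
    quotients by 2 are [cosh] and [sinh] of [gamma / 4 + i alpha / 2].  By the
    hypotheses on [x] and [b], [E] is [x + b] up to sign, with inverse [x - b]
    up to the same sign, so that [cosh] and [sinh] are [x * c + b * sg] and
    [x * sg + b * c], again up to a common sign. *)
Lemma tanh_shift (F : numFieldType) (c sg h x b E : F) :
    c ^+ 2 - sg ^+ 2 = 1 -> c != 0 ->
    x ^+ 2 - b ^+ 2 = 1 -> b * (c ^+ 2 - sg ^+ 2 * h) = sg * c * x * (h - 1) ->
    (x + b) ^+ 2 = E ^+ 2 ->
  sg * h * ((E * (c + sg) + (E * (c + sg))^-1) / 2) =
   c * ((E * (c + sg) - (E * (c + sg))^-1) / 2) /\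
  (E * (c + sg) + (E * (c + sg))^-1) / 2 != 0.
Proof.
move=> unim c0 hx key hE.
have sumV : (c + sg)^-1 = c - sg by apply: mulr1_eq; rewrite -unim; ring.
have EV : (x + b) * (x - b) = 1 by rewrite -hx; ring.
(* If this vanished, the equation would give b = 0, and then x = 0. *)
have den_neq0 : x * c + b * sg != 0.
  apply/eqP => den0.
  have b0 : b = 0.
    have -> : b = b * (c ^+ 2 - sg ^+ 2) by rewrite unim mulr1.
    have -> : b * (c ^+ 2 - sg ^+ 2) = b * (c ^+ 2 - sg ^+ 2 * h)
      - sg * c * x * (h - 1) + (x * c + b * sg) * sg * (h - 1) by ring.
    by rewrite key subrr den0 !mul0r addr0.
  move: den0 hx; rewrite b0 mul0r addr0 => /eqP.
  rewrite mulf_eq0 (negPf c0) orbF => /eqP ->; rewrite expr0n subrr => /eqP.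
  by rewrite eq_sym oner_eq0.
have num : sg * h * (x * c + b * sg) = c * (x * sg + b * c).
  apply/eqP; rewrite -subr_eq0; apply/eqP.
  rewrite -[RHS](subrr (sg * c * x * (h - 1))) -{2}key; ring.
rewrite invfM sumV; have /eqP := hE; rewrite eqf_sqr => /orP[] /eqP EE.
- have -> : E^-1 = x - b by rewrite -EE; apply: mulr1_eq.
  have -> : (E * (c + sg) + (x - b) * (c - sg)) / 2 = x * c + b * sg.
    by rewrite -EE; field.
  by split=> //; rewrite num -EE; field.
- have {}EE : E = - (x + b) by rewrite EE opprK.
  have -> : E^-1 = - (x - b) by rewrite EE; apply: mulr1_eq; rewrite mulrNN.
  have -> : (E * (c + sg) + - (x - b) * (c - sg)) / 2 = - (x * c + b * sg).
    by rewrite EE; field.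
  by rewrite oppr_eq0; split=> //; rewrite mulrN num EE; field.
Qed.

(** * The Pythagorean theorem of the cone-manifold *)

Theorem theorem4p3 (R : realType) (n : int) (hn0 : n != 0) (hn1 : n != -1)
  (alpha0 : R) (halpha0 : transition_angle n alpha0)
  (alpha : R) (halpha : 0 < alpha < alpha0)
  (d : 'rV[R]_4 -> 'rV[R]_4 -> R)
  (hd : cone_manifold Hyperbolic (twist_knot n) alpha d)
  (x0 : 'rV[R]_4) (hx0 : knot_exterior n x0)
  (G : groupType) (cls : (R -> 'rV[R]_4) -> G)
  (hG : fundamental_group (knot_exterior n) x0 cls)
  (s t : G)
  (hs : is_meridian (twist_knot n) x0 cls s)
  (ht : is_meridian (twist_knot n) x0 cls t)
  (hpres : twist_presentation n s t)
  (eta : G -> 'M[R[i]]_2)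
  (heta : is_holonomy_lift (knot_exterior n) d x0 cls eta)
  (htrS : \tr (eta s) = (2 * cos (alpha / 2))%:C)
  (htrT : \tr (eta t) = (2 * cos (alpha / 2))%:C)
  (axisS axisT : oriented_line)
  (haxisS : rotation_axis alpha (eta s) axisS)
  (haxisT : rotation_axis alpha (eta t) axisT)
  (rho : R[i]) (hrho : complex_distance axisS axisT rho)
  (gamma : R[i])
  (hgamma : longitude_length alpha (eta t) (eta (longitude n s t)) gamma) :
  'i%C * coshC rho
    = (cot (alpha / 2))%:C * tanhC (gamma / 4 + 'i%C * (alpha / 2)%:C).
Proof.
have [det_eta etaM _] := heta.
have [/andP[_ alpha0_pi] _ _ _] := halpha0.
have /andP[alpha_gt0 alpha_lt] := halpha.
have sin_gt0 : 0 < sin (alpha / 2) by apply: sin_gt0_pi; lra.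
have cos_gt0 : 0 < cos (alpha / 2) by apply: cos_gt0_pihalf; lra.
have [Q uQ [NS NT]] := complex_distance_normal_form haxisS haxisT hrho.
set c := (cos (alpha / 2))%:C in NS NT.
set sn := (sin (alpha / 2))%:C in NS NT.
set sg := 'i%C * sn in NS NT.
set e := expC (rho / 2) in NS NT.
have c0 : c != 0 by rewrite (inj_eq (@complexI _)) gt_eqF.
have sn0 : sn != 0 by rewrite (inj_eq (@complexI _)) gt_eqF.
have i0 : 'i%C != 0 :> R[i] by rewrite eq_complex /= oner_eq0 andbF.
have sg0 : sg != 0 by rewrite mulf_neq0.
have e0 : e != 0 by exact: expC_neq0.
have unim : c ^+ 2 - sg ^+ 2 = 1.
  rewrite exprMn sqr_i mulN1r opprK -!rmorphXn -rmorphD /= cos2Dsin2.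
  by rewrite rmorph1.
have := conj_SL2_repr det_eta etaM uQ.
set theta := fun g : G => Q^-1 * eta g * Q => -[det_theta thetaM].
have [rel _] := hpres.
have [x [b [xb key eig]]] :=
  twist_longitude_eigenvector unim e0 sg0 det_theta thetaM NS NT rel.
have coshE : (e ^+ 2 + e ^- 2) / 2 = coshC rho.
  by rewrite /coshC expCN /e -expC_half.
rewrite coshE in key.
have transport (M : 'M[R[i]]_2) (v : 'cV[R[i]]_2) l :
    Q^-1 * M * Q *m v = l *: v -> M *m (Q *m v) = l *: (Q *m v).
  by move=> h; rewrite scalemxAr -h !mulmxA [Q *m Q^-1](mulmxV uQ) mul1mx.
have eigT : eta t *m (Q *m col2 e 1) = (c + sg) *: (Q *m col2 e 1).
  apply: transport; rewrite [_ * Q]NT mx2_col scale_col2.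
  by congr col2; field.
have v0 : Q *m col2 e 1 != 0.
  apply/eqP => /(congr1 (mulmx (invmx Q))); rewrite mulKmx // mulmx0.
  by move/matrixP/(_ 1 0); rewrite !mxE /= => /eqP; rewrite oner_eq0.
have gammaE : (x + b) ^+ 2 = expC (gamma / 2).
  apply: (longitude_length_eigen _ _ (transport _ _ _ eig) v0 hgamma).
    by rewrite gt_eqF.
  by rewrite expC_i.
have half : gamma / 2 / 2 = gamma / 4 by field.
rewrite expC_half half in gammaE.
have [main den0] := tanh_shift unim c0 xb key gammaE.
set z := gamma / 4 + 'i%C * (alpha / 2)%:C.
have zE : expC (gamma / 4) * (c + sg) = expC z by rewrite expCD expC_i.
rewrite zE -expCN -/(coshC z) -/(sinhC z) in main den0.
have -> : (cot (alpha / 2))%:C = c / sn by rewrite /cot fmorph_div.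
rewrite /tanhC mulf_div; apply: (canRL (mulfK _)); first exact: mulf_neq0.
by rewrite -main /sg mulrA (mulrAC 'i%C).
Qed.
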